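(* Assume that $f=[f_0:f_1]:\mathbb{R}\to\mathbb{TP}^1$ is a nonconstant tropical meromorphic function with $\limsup_{r\to\infty}\frac{\log T_f(r)}{r}=0$. (i) Let $a_j=[a_{j1}:a_{j0}]$ $(j=1,\dots,q)$ be distinct values of $\mathbb{TP}^1$, defining tropical polynomials $P_j(x)=(a_{j0}\odot x_0)\oplus(a_{j1}\odot x_1)$ on $\mathbb{R}^2$, respectively. If $\mathrm{ddg}(\{P_3\circ f,\dots,P_q\circ f\})=\lambda$, then $\sum_{j=3}^{q}\delta_f(a_j)\le\lambda$. In the special case $\lambda=0$, $\delta_f(a_j)=0$ holds for each $a_j$ $(j\in\{3,4,\dots,q\})$. (ii) $\delta_f(a)=0$ holds for each $a\in\mathbb{R}$ such that $f\oplus a\not\equiv a$.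
   Context: Tropical semiring: $\mathbb{R}_{\max}=\mathbb{R}\cup\{-\infty\}$ with $x\oplus y=\max(x,y)$, $x\odot y=x+y$, $x\oslash y=x-y$, $0_o=-\infty$, $1_o=0$. $\mathbb{TP}^1$ is $\mathbb{R}_{\max}^{2}\setminus\{(0_o,0_o)\}$ modulo $(a,b)\sim(\mu+a,\mu+b)$, $\mu\in\mathbb{R}$; it is identified with $\mathbb{R}\cup\{\pm\infty\}$ by letting $[a_1:a_0]$ correspond to $a=a_0\oslash a_1=a_0-a_1$ (so $-\infty=[1_o:0_o]$, $+\infty=[0_o:1_o]$). A tropical meromorphic function is a continuous piecewise linear $f:\mathbb{R}\to\mathbb{R}$ (possibly infinitely many pieces, derivative discontinuities locally finite). With $\omega_f(x)=\lim_{\varepsilon\to0+}\{f'(x+\varepsilon)-f'(x-\varepsilon)\}$, $x$ is a zero of multiplicity $\omega_f(x)$ if $\omega_f(x)>0$ and a pole of multiplicity $-\omega_f(x)$ if $\omega_f(x)<0$. A tropical entire function is a tropical meromorphic function without poles (equivalently, convex). $n(r,f)$ is the number of poles of $f$ in $(-r,r)$ counted with multiplicity, and $N(r,f)=\frac12\int_0^r n(t,f)\,dt$. So $N(r,1_o\oslash h)$, where $1_o\oslash h=-h$, counts the zeros of $h$. The notation $f=[f_0:f_1]$ means $f=f_1\oslash f_0=f_1-f_0$ with $f_0,f_1$ tropical entire functions without common zeros. With $\|f(x)\|=\max\{f_0(x),f_1(x)\}$, $T_f(r)=\frac12[\|f(r)\|+\|f(-r)\|]-\|f(0)\|$. For $F=(b_0\odot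 f_0)\oplus(b_1\odot f_1)$ with $b_0,b_1\in\mathbb{R}_{\max}$ not both $0_o$, $\ell(F)=1$ if $F=b\odot f_0$ or $F=b\odot f_1$ for some $b\in\mathbb{R}$, and $\ell(F)=2$ otherwise. The degree of degeneracy $\mathrm{ddg}(Q)$ of a collection $Q$ of such $F$ is the number of elements $F$ of $Q$ with $\ell(F)<2$ (here the elements are indexed by $j=3,\dots,q$). Defect: for $a=[a_1:a_0]\in\mathbb{TP}^1$ let $P(x)=(a_0\odot x_0)\oplus(a_1\odot x_1)$ and $P\circ f=(a_0\odot f_0)\oplus(a_1\odot f_1)$; then $$\delta_f(a)=1-\limsup_{r\to\infty}\frac{N(r,1_o\oslash(P\circ f))}{T_f(r)}.$$ *)

(* Defs.v *)
From HB Require Import structures.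
From mathcomp Require Import all_boot all_order all_algebra.
From mathcomp Require Import generic_quotient.
From mathcomp Require Import all_classical all_reals all_analysis.

Set Implicit Arguments.
Unset Strict Implicit.
Unset Printing Implicit Defensive.
Import Order.TTheory GRing.Theory Num.Theory.
Import numFieldNormedType.Exports.

Local Open Scope classical_set_scope.
Local Open Scope quotient_scope.
Local Open Scope ring_scope.

Section ProjectiveLine.
Variable R : realType.

(* R_max is the set of x : \bar R with x != +oo: 0_o is -oo, 1_o is 0, the
   tropical sum is maxe and the tropical product is +%E. *)

(* A pair (x1, x0) of elements of R_max, not both 0_o: the homogeneous
   coordinates of the point [x1 : x0]. *)
Definition is_hcoord (p : \bar R * \bar R) : bool :=
  [&& p.1 != +oo%E, p.2 != +oo%E & p != (-oo%E, -oo%E)].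

Definition hcoord := {p : \bar R * \bar R | is_hcoord p}.

Definition hc1 (p : hcoord) : \bar R := (val p).1.
Definition hc0 (p : hcoord) : \bar R := (val p).2.

Definition tp_equiv (p p' : hcoord) : bool :=
  `[< exists mu : R,
        hc1 p' = (mu%:E + hc1 p)%E /\ hc0 p' = (mu%:E + hc0 p)%E >].

Lemma tp_equiv_refl : reflexive tp_equiv.
Proof. by move=> p; apply/asboolP; exists 0; rewrite !add0e. Qed.

Lemma tp_equiv_sym : symmetric tp_equiv.
Proof.
have H p p' : tp_equiv p p' -> tp_equiv p' p.
  move=> /asboolP[mu [e1 e0]]; apply/asboolP; exists (- mu).
  by rewrite e1 e0 !addeA -!EFinD addNr !add0e.
by move=> p p'; apply/idP/idP; apply: H.
Qed.

Lemma tp_equiv_trans : transitive tp_equiv.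
Proof.
move=> p' p p'' /asboolP[mu [e1 e0]] /asboolP[nu [e1' e0']]; apply/asboolP.
by exists (nu + mu); rewrite e1' e0' e1 e0 !EFinD !addeA.
Qed.

Canonical tp_equiv_rel :=
  EquivRel tp_equiv tp_equiv_refl tp_equiv_sym tp_equiv_trans.

Definition TP1 := {eq_quot tp_equiv}.

Definition tp_class (p : hcoord) : TP1 := \pi_TP1 p.
Definition tp_coord (a : TP1) : hcoord := repr a.

Lemma tp_classP p p' : (tp_class p = tp_class p') <-> tp_equiv p p'.
Proof.
split; first by move/eqmodP.
by move=> h; apply/eqmodP.
Qed.

Lemma tp_coordK a : tp_class (tp_coord a) = a.
Proof. exact: reprK. Qed.

Lemma real_hcoord_subproof (a : R) : is_hcoord (0%E, a%:E).
Proof. by []. Qed.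

Definition real_hcoord (a : R) : hcoord := exist is_hcoord _ (real_hcoord_subproof a).

(* a real number a is identified with [1_o : a], since a = a_0 - a_1 *)
Definition tp_of_real (a : R) : TP1 := tp_class (real_hcoord a).

End ProjectiveLine.

Section TropicalNevanlinna.
Variable R : realType.
Implicit Types (f F : R -> R) (r x : R).

Definition locally_finite (B : set R) : Prop :=
  forall r, finite_set (B `&` [set x | - r <= x <= r]).

Definition piecewise_linear f : Prop :=
  exists B : set R, locally_finite B /\
    forall u v : R, (forall x, u < x < v -> ~ B x) ->
      exists c d : R, forall x, u < x < v -> f x = c * x + d.

Definition tropical_meromorphic f : Prop :=
  continuous f /\ piecewise_linear f.

Definition omega f x : R :=
  lim ((derive1 f (x + e) - derive1 f (x - e)) @[e --> 0^'+]).

Definition is_zero f x : Prop := 0 < omega f x.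
Definition is_pole f x : Prop := omega f x < 0.

Definition tropical_entire f : Prop :=
  tropical_meromorphic f /\ forall x, ~ is_pole f x.

(* number of poles in (-r, r), counted with multiplicity - omega *)
Definition pole_count f r : R :=
  \sum_(x \in [set x | - r < x < r /\ is_pole f x]) (- omega f x).

Definition Npole f r : R :=
  2^-1 * \int[lebesgue_measure]_(t in `[0, r]) pole_count f t.

(* f = [f0 : f1], i.e. f = f1 - f0 *)
Definition represents f f0 f1 : Prop :=
  [/\ tropical_entire f0, tropical_entire f1,
      (forall x, ~ (is_zero f0 x /\ is_zero f1 x)) &
      (forall x, f x = f1 x - f0 x)].

Definition tnorm f0 f1 x : R := Num.max (f0 x) (f1 x).

Definition Tchar f0 f1 r : R :=
  2^-1 * (tnorm f0 f1 r + tnorm f0 f1 (- r)) - tnorm f0 f1 0.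

(* fine is harmless: the maximum is a real number for p : hcoord R *)
Definition tpoly (p : hcoord R) (x0 x1 : R) : R :=
  fine (maxe (hc0 p + x0%:E) (hc1 p + x1%:E)).

Definition tpoly_comp (p : hcoord R) f0 f1 : R -> R :=
  fun x => tpoly p (f0 x) (f1 x).

Definition ell f0 f1 F : nat :=
  if `[< exists b : R, (forall x, F x = b + f0 x) \/ (forall x, F x = b + f1 x) >]
  then 1 else 2.

(* the collection is a sequence, so that it is counted by indices *)
Definition ddg f0 f1 (Q : seq (R -> R)) : nat :=
  count (fun F => (ell f0 f1 F < 2)%N) Q.

Definition defect_hc f0 f1 (p : hcoord R) : \bar R :=
  (1 - limf_esup
         (fun r => (Npole (fun x => - tpoly_comp p f0 f1 x) r
                      / Tchar f0 f1 r)%:E)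
         (pinfty_nbhs R))%E.

(* independent of the coordinates, see defect_class *)
Definition defect f0 f1 (a : TP1 R) : \bar R := defect_hc f0 f1 (tp_coord a).

Lemma tpoly_shift (p p' : hcoord R) : tp_equiv p p' ->
  exists mu, forall x0 x1, tpoly p' x0 x1 = mu + tpoly p x0 x1.
Proof.
case: p => -[p1 p0] hp; case: p' => -[p1' p0'] hp'.
move=> /asboolP[mu []]; rewrite /tpoly /hc1 /hc0 /= => e1 e0; exists mu => x0 x1.
move: hp {hp'}; rewrite {}e1 {}e0 /is_hcoord /=.
case: p1 p0 => [y1||] [y0||] //= _.
- by rewrite -!EFinD -!EFin_max /= -!addrA -addr_maxr.
- by rewrite !maxNye /= addrA.
- by rewrite addrA.
Qed.

Lemma omega_shift f c : omega (fun x => c + f x) = omega f.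
Proof.
have E : derive1 (fun x => c + f x) = derive1 f.
  apply/funext => x; rewrite /derive1.
  under eq_fun do rewrite opprD addrACA subrr add0r.
  reflexivity.
by apply/funext => x; rewrite /omega E.
Qed.

Lemma defect_class f0 f1 p : defect f0 f1 (tp_class p) = defect_hc f0 f1 p.
Proof.
have /tp_classP/tpoly_shift[mu E] : tp_class p = tp_class (tp_coord (tp_class p)).
  by rewrite tp_coordK.
have {}E : (fun x => - tpoly_comp (tp_coord (tp_class p)) f0 f1 x) =
           (fun x => - mu + (- tpoly_comp p f0 f1 x)).
  by apply/funext => x; rewrite /tpoly_comp E opprD.
by rewrite /defect /defect_hc E /Npole /pole_count /is_pole omega_shift.
Qed.

End TropicalNevanlinna.

(* Main.v *)
(* Write F = (b0 + f0) max (b1 + f1) and M = f0 max f1, and for a function G put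
   J_G(r) = (G(r) + G(-r)) / 2 - G(0), so that T_f = J_M. On [-r, r] the function F is an
   affine function plus a finite sum of hinges w_p max(x - p, 0) with w_p = omega_F(p) >= 0;
   integrating the zero counting function hinge by hinge gives N(r, -F) = J_F(r).
   When b0 and b1 are real, F - M is bounded, hence N(r, -F) = T_f(r) + O(1). Since M is
   convex, T_f(r) / r is nondecreasing, and T_f = 0 would force f0, f1 to differ by a
   constant; so T_f tends to infinity and the defect is 0. When b0 or b1 is -oo, F is b + f0
   or b + f1, an element counted by ddg, whose defect is at most 1 because N >= 0. *)

Require Import Defs.
From HB Require Import structures.
From mathcomp Require Import all_boot all_order all_algebra.
From mathcomp Require Import all_classical all_reals all_analysis.
From mathcomp Require Import measurable_realfun.
From mathcomp Require Import ring lra.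
Import Order.TTheory GRing.Theory Num.Theory.
Import numFieldNormedType.Exports.
Local Open Scope classical_set_scope.
Local Open Scope ring_scope.

(** * Piecewise linear functions on compact intervals and their hinge decomposition *)

Section Pl.
Variable R : realType.

(** An inductive form, so that closure properties follow by induction on the subdivision. Pieces are
    closed and share endpoints, which builds in continuity; on an empty interval the affine case
    holds vacuously. *)
Inductive pl (f : R -> R) : R -> R -> Prop :=
| pl_affine u v c d : (forall x, u <= x <= v -> f x = c * x + d) -> pl f u v
| pl_cat u w v : u < w < v -> pl f u w -> pl f w v -> pl f u v.

End Pl.

Arguments pl {R}.
Arguments pl_affine {R f u v}.
Arguments pl_cat {R f u} w {v}.

Section PiecewiseLinear.
Set Implicit Arguments.
Unset Strict Implicit.
Variable R : realType.
Implicit Types f g h : R -> R.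

Lemma pl_sub f u v u' v' : pl f u v -> u <= u' -> v' <= v -> pl f u' v'.
Proof.
move=> H; elim: H u' v' => {u v} [u v c d E|u w v uwv _ IH1 _ IH2] u' v' uu' vv'.
  apply: (pl_affine c d) => x xuv; apply: E; lra.
have [wu'|u'w] := leP w u'; first exact: IH2.
have [v'w|wv'] := leP v' w; first exact: IH1.
by apply: (pl_cat w); [rewrite u'w|exact: IH1|exact: IH2].
Qed.

Lemma plD f g u v : pl f u v -> pl g u v -> pl (fun x => f x + g x) u v.
Proof.
move=> H; elim: H => {u v} [u v c d E|u w v uwv _ IH1 _ IH2] G.
  (* With [f] affine on the whole interval, a second induction runs over the subdivision of [g]. *)
  elim: G E => {u v} [u v c' d' E'|u w v uwv _ IH1 _ IH2] E.
    by apply: (pl_affine (c + c') (d + d')) => x xuv; rewrite E// E'//; ring.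
  by apply: (pl_cat w) => //; [apply: IH1|apply: IH2] => x xuv; apply: E; lra.
by apply: (pl_cat w) => //; [apply: IH1|apply: IH2]; apply: (pl_sub G); lra.
Qed.

Lemma plN f u v : pl f u v -> pl (fun x => - f x) u v.
Proof.
elim=> {u v} [u v c d E|u w v uwv _ IH1 _ IH2]; last exact: (pl_cat w).
by apply: (pl_affine (- c) (- d)) => x xuv; rewrite E//; ring.
Qed.

(** An affine function changes sign at most once, so one extra cut per piece, at its root, is
    enough. *)
Lemma pl_max0 f u v : pl f u v -> pl (fun x => Num.max (f x) 0) u v.
Proof.
elim=> {u v} [u v c d E|u w v uwv _ IH1 _ IH2]; last exact: (pl_cat w).
have pos u' v' : u <= u' -> v' <= v -> (forall x, u' <= x <= v' -> 0 <= c * x + d) ->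
    pl (fun x => Num.max (f x) 0) u' v'.
  move=> uu' vv' P; apply: (pl_affine c d) => x xuv.
  by rewrite E ?max_l ?P//; lra.
have neg u' v' : u <= u' -> v' <= v -> (forall x, u' <= x <= v' -> c * x + d <= 0) ->
    pl (fun x => Num.max (f x) 0) u' v'.
  move=> uu' vv' P; apply: (pl_affine 0 0) => x xuv.
  by rewrite E ?max_r ?P//; lra.
(* [z] is the root. For [c = 0] the quotient is 0 and the right alternative records that the piece
   is constant, so a cut there does no harm. *)
have [z zP] : exists z, forall x, c * x + d = c * (x - z) \/ c * x + d = d /\ c = 0.
  exists (- d / c) => x; have [->|c0] := eqVneq c 0.
    by right; rewrite mul0r add0r.
  by left; field.
have side (a b : R) : u <= a -> b <= v -> (z <= a) || (b <= z) ->
    pl (fun x => Num.max (f x) 0) a b.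
  move=> ua bv side.
  have [c0|c0|c0] := ltgtP c 0; first last.
  - have [d0|d0] := leP 0 d; [apply: pos|apply: neg] => // x; rewrite c0; lra.
  - case/orP: side => ?; [apply: pos|apply: neg] => // x xab;
      case: (zP x) => [->|[-> c00]]; first [nra|by rewrite c00 ltxx in c0].
  - case/orP: side => ?; [apply: neg|apply: pos] => // x xab;
      case: (zP x) => [->|[-> c00]]; first [nra|by rewrite c00 ltxx in c0].
have [zu|uz] := leP z u; first by apply: side; rewrite // zu.
have [vz|zv] := leP v z; first by apply: side; rewrite // vz orbT.
apply: (pl_cat z); [by rewrite uz| |]; apply: side; rewrite ?lexx ?orbT//; exact: ltW.
Qed.

Lemma pl_max f g u v : pl f u v -> pl g u v -> pl (fun x => Num.max (f x) (g x)) u v.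
Proof.
move=> F G; have -> : (fun x => Num.max (f x) (g x)) =
    (fun x => Num.max (f x + - g x) 0 + g x).
  by apply/funext => x; rewrite addr_maxl subrK add0r.
by apply: plD => //; apply: pl_max0; apply: plD => //; apply: plN.
Qed.

Lemma pl_cst (c : R) u v : pl (fun=> c) u v.
Proof. by apply: (pl_affine 0 c) => x _; rewrite mul0r add0r. Qed.

(** Each slope jump becomes a hinge. Gluing at [m] keeps the affine part of the left piece and puts
    a new hinge at [m] to correct the slope. *)
Lemma pl_sum_hinges f u v : u < v -> pl f u v -> exists c d (s : seq R) (w : R -> R),
  [/\ uniq s, {in s, forall p, u < p < v} & forall x, u <= x <= v ->
    f x = c * x + d + \sum_(p <- s) w p * Num.max (x - p) 0].
Proof.
move=> + H; elim: H => {u v} [u v c d E _|u m v umv _ IH1 _ IH2 uv].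
  exists c, d, [::], (fun=> 0); split => // x xuv.
  by rewrite big_nil addr0 E.
case/andP: umv => um mv.
have [c1 [d1 [s1 [w1 [us1 is1 E1]]]]] := IH1 um.
have [c2 [d2 [s2 [w2 [us2 is2 E2]]]]] := IH2 mv.
(* [k] is the slope of the left formula beyond all its hinges; a hinge of weight [c2 - k] at [m]
   turns it into the initial slope of the right formula. *)
pose k := c1 + \sum_(p <- s1) w1 p.
pose w p := if p < m then w1 p else if p == m then c2 - k else w2 p.
have S1 x : m <= x -> \sum_(p <- s1) w1 p * Num.max (x - p) 0 =
    \sum_(p <- s1) w1 p * Num.max (m - p) 0 + (x - m) * \sum_(p <- s1) w1 p.
  move=> mx; rewrite mulr_sumr -big_split/=; apply: eq_big_seq => p /is1 pm.
  rewrite !max_l; [ring|lra|lra].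
have S2 x : x <= m -> \sum_(p <- s2) w2 p * Num.max (x - p) 0 = 0.
  move=> xm; rewrite big_seq big1// => p /is2 pm.
  rewrite max_r ?mulr0//; lra.
exists c1, d1, (s1 ++ m :: s2), w; split.
- rewrite cat_uniq us1/= us2 andbT.
  have ms2 : m \notin s2 by apply/negP => /is2; rewrite ltxx.
  have ms1 : m \notin s1 by apply/negP => /is1; rewrite ltxx andbF.
  rewrite ms2 negb_or ms1 !andbT/=; apply/hasPn => p /is2 pm /=.
  by apply/negP => /is1; lra.
- move=> p; rewrite mem_cat inE => /orP[/is1|/orP[/eqP->|/is2]]; lra.
move=> x xuv; rewrite big_cat big_cons/=.
have -> : \sum_(p <- s1) w p * Num.max (x - p) 0 =
    \sum_(p <- s1) w1 p * Num.max (x - p) 0.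
  by apply: eq_big_seq => p /is1 /andP[_ pm]; rewrite /w pm.
have -> : \sum_(p <- s2) w p * Num.max (x - p) 0 =
    \sum_(p <- s2) w2 p * Num.max (x - p) 0.
  apply: eq_big_seq => p /is2 /andP[mp _].
  by rewrite /w ltNge (ltW mp)/= gt_eqF.
have -> : w m = c2 - k by rewrite /w ltxx eqxx.
have [xm|mx] := leP x m.
  rewrite S2// max_r; last by lra.
  rewrite E1; [ring|lra].
(* Both formulas give [f m], which determines [d2]. *)
have F1 := E1 m; have F2 := E2 m.
rewrite S2// in F2.
rewrite S1 ?(ltW mx)// max_l ?E2; [|lra|lra].
rewrite /k; lra.
Qed.

(** At an endpoint both sides are one-sided limits of functions that agree inside the interval. *)
Lemma affine_closed_itv f u v c d : continuous f -> u < v ->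
  (forall x, u < x < v -> f x = c * x + d) -> forall x, u <= x <= v -> f x = c * x + d.
Proof.
move=> cf uv E x /andP[ux xv].
have cg : continuous (fun y : R => c * y + d).
  by move=> y; apply: cvgD; [apply: cvgM; [exact: cvg_cst|exact: cvg_id]|exact: cvg_cst].
have [xu|xu] := eqVneq x u.
  subst x; have A : f y @[y --> u^'+] --> f u by apply: cvg_at_right_filter; exact: cf.
  apply: (cvg_unique (@Rhausdorff R) A).
  apply: (@cvg_trans _ ((fun y => c * y + d) y @[y --> u^'+])).
    apply: near_eq_cvg; near=> y; apply/esym/E; apply/andP; split; near: y.
      exact: nbhs_right_gt.
    exact: nbhs_right_lt.
  by apply: cvg_at_right_filter; exact: cg.
have [xv'|xv'] := eqVneq x v; last by apply: E; rewrite !lt_neqAle ux xv xv' eq_sym xu.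
subst x; have A : f y @[y --> v^'-] --> f v by apply: cvg_at_left_filter; exact: cf.
apply: (cvg_unique (@Rhausdorff R) A).
apply: (@cvg_trans _ ((fun y => c * y + d) y @[y --> v^'-])).
  apply: near_eq_cvg; near=> y; apply/esym/E; apply/andP; split; near: y.
    exact: nbhs_left_gt.
  exact: nbhs_left_lt.
by apply: cvg_at_left_filter; exact: cg.
Unshelve. all: by end_near. Qed.

(** Induction on the list of possible breakpoints: its head either cuts the interval or lies outside
    and is dropped. The hypothesis ranges over all subintervals so that it passes to both halves,
    and [s] may be unsorted. *)
Lemma pl_breaks f (s : seq R) u v : continuous f -> u < v ->
  (forall a b, u <= a -> b <= v -> (forall x, a < x < b -> x \notin s) ->
     exists c d, forall x, a < x < b -> f x = c * x + d) ->
  pl f u v.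
Proof.
move=> cf; elim: s u v => [|p s IH] u v uv E.
  have [//|//|//|c [d {}E]] := E u v.
  exact/(pl_affine c d)/affine_closed_itv.
have [/andP[up pv]|puv] := boolP (u < p < v).
  apply: (pl_cat p); first exact/andP.
    apply: IH => // a b ua bp sab; apply: E => //; first by lra.
    by move=> x xab; rewrite inE negb_or sab// andbT; apply/eqP; lra.
  apply: IH => // a b pa bv sab; apply: E => //; first by lra.
  by move=> x xab; rewrite inE negb_or sab// andbT; apply/eqP; lra.
apply: IH => // a b ua bv sab; apply: E => // x xab.
rewrite inE negb_or sab// andbT; apply/eqP => xp; move: puv; rewrite -xp; lra.
Qed.

Lemma tropical_meromorphic_pl f u v : tropical_meromorphic f -> pl f u v.
Proof.
move=> [cf [B [lfB BE]]].
(* Local finiteness speaks of symmetric intervals, so the interval is first enlarged to one. *)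
have [r [r0 ru vr]] : exists r, [/\ 0 < r, - r <= u & v <= r].
  exists (`|u| + `|v| + 1); have := ler_norm (- u); have := ler_norm v; rewrite normrN.
  by have := normr_ge0 u; have := normr_ge0 v; split; lra.
apply: (@pl_sub f (- r) r) => //.
have /finite_seqP[s sE] := lfB r.
apply: (@pl_breaks f s) => //; first by lra.
move=> a b ra br sab; apply: BE => x xab Bx.
have : [set` s] x by rewrite -sE; split=> //=; lra.
by rewrite /= (negPf (sab _ xab)).
Qed.

End PiecewiseLinear.

(** * Slope jumps and the counting of zeros *)

Section Kinks.
Set Implicit Arguments.
Unset Strict Implicit.
Variable R : realType.
Implicit Types f g F : R -> R.

(* near x, f has slope c on the left and slope c + w on the right *)
Definition kink f x w := exists c n, 0 < n /\ forall e : R, 0 <= e < n ->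
  f (x + e) = f x + (c + w) * e /\ f (x - e) = f x - c * e.

Lemma kink_omega f x w : kink f x w -> omega f x = w.
Proof.
move=> [c [n [n0 H]]].
(* A function that is affine near [a] has its slope as derivative there. *)
have der (a k : R) (b : R) (m : R) : 0 < m -> (forall y, `|y - a| < m -> f y = b + k * y) ->
    derive1 f a = k.
  move=> m0 E; rewrite derive1E.
  have Ea : \near a, b + k * a = f a.
    near=> y; apply/esym/E; rewrite distrC; near: y.
    exact: cvgr_dist_lt.
  have D : is_derive a 1 (fun y : R => b + k * y) (0 + k *: 1).
    exact: is_deriveD.
  have [_ ->] := near_eq_is_derive Ea D.
  by rewrite add0r /GRing.scale/= mulr1.
apply: lim_near_cst => //.
near=> e.
have e0 : 0 < e by near: e; exact: nbhs_right_gt.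
have en : e < n by near: e; exact: nbhs_right_lt.
(* The balls of radius [m] around [x + e] and [x - e] stay on one side of [x] and within distance
   [n], where [f] is affine. *)
pose m := Num.min e (n - e).
have m0 : 0 < m by rewrite /m lt_min e0 subr_gt0.
have me : m <= e by rewrite /m ge_min lexx.
have mne : m <= n - e by rewrite /m ge_min lexx orbT.
rewrite (@der (x + e) (c + w) (f x - (c + w) * x) m)//; last first.
  move=> y; rewrite ltr_norml => yxe.
  have -> : y = x + (y - x) by ring.
  by have [-> _] := H (y - x) ltac:(lra); ring.
rewrite (@der (x - e) c (f x - c * x) m)//; first by ring.
move=> y; rewrite ltr_norml => yxe.
have -> : y = x - (x - y) by ring.
by have [_ ->] := H (x - y) ltac:(lra); ring.
Unshelve. all: by end_near. Qed.

Lemma kink_affine c d x : kink (fun y => c * y + d) x 0.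
Proof. by exists c, 1; split => // e _; split; ring. Qed.

Lemma kinkD f g x v w : kink f x v -> kink g x w -> kink (fun y => f y + g y) x (v + w).
Proof.
move=> [c [n [n0 H]]] [c' [n' [n0' H']]].
exists (c + c'), (Num.min n n'); split; first by rewrite lt_min n0.
move=> e; rewrite lt_min => /and3P[e0 en en'].
have [|-> ->] := H e; first by rewrite e0.
have [|-> ->] := H' e; first by rewrite e0.
by split; ring.
Qed.

Lemma kinkZ f a x w : kink f x w -> kink (fun y => a * f y) x (a * w).
Proof.
move=> [c [n [n0 H]]]; exists (a * c), n; split=> // e en.
by have [-> ->] := H e en; split; ring.
Qed.

Lemma kinkN f x w : kink f x w -> kink (fun y => - f y) x (- w).
Proof.
move=> [c [n [n0 H]]]; exists (- c), n; split=> // e en.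
by have [-> ->] := H e en; split; ring.
Qed.

Lemma kink_hinge p x : kink (fun y => Num.max (y - p) 0) x (x == p)%:R.
Proof.
have [xp|xp|->] := ltgtP x p; rewrite /kink /= ?mulr1n ?mulr0n; first last.
- exists 0, 1; split => // e /andP[e0 _].
  rewrite subrr maxxx (@max_l _ _ (p + e - p)) ?(@max_r _ _ (p - e - p)); [|lra..].
  by split; ring.
- exists 1, (x - p); split => [|e exp]; first by rewrite subr_gt0.
  by rewrite !max_l; [split; ring|lra..].
- exists 0, (p - x); split => [|e exp]; first by rewrite subr_gt0.
  by rewrite !max_r; [split; ring|lra..].
Qed.

Lemma kink_sum_hinges (s : seq R) (w : R -> R) x :
  kink (fun y => \sum_(p <- s) w p * Num.max (y - p) 0) x
       (\sum_(p <- s) w p * (x == p)%:R).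
Proof.
elim: s => [|p s IH].
  rewrite big_nil; under [X in kink X]funext do rewrite big_nil.
  by exists 0, 1; split => // e _; split; ring.
rewrite big_cons; under [X in kink X]funext do rewrite big_cons.
by apply: kinkD => //; apply: kinkZ; exact: kink_hinge.
Qed.

Lemma kink_near f g u v x w : u < x < v -> (forall y, u <= y <= v -> f y = g y) ->
  kink g x w -> kink f x w.
Proof.
move=> xuv fg [c [n [n0 H]]].
exists c, (Num.min n (Num.min (x - u) (v - x))); split.
  by rewrite !lt_min n0; lra.
move=> e; rewrite !lt_min => en.
have [|E1 E2] := H e; first by lra.
by rewrite !fg ?E1 ?E2//; lra.
Qed.

(** Since [s] has no repetition, the jump at a point is a single weight; the weights of a hinge
    decomposition are thus values of [omega]. *)
Lemma sum_hinges_kink f u v c d (s : seq R) (w : R -> R) x : uniq s -> u < x < v ->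
  (forall y, u <= y <= v -> f y = c * y + d + \sum_(p <- s) w p * Num.max (y - p) 0) ->
  kink f x (if x \in s then w x else 0).
Proof.
move=> us xuv E; apply: (kink_near xuv E).
have -> : (if x \in s then w x else 0) = 0 + \sum_(p <- s) w p * (x == p)%:R.
  rewrite add0r; case: ifPn => xs.
    rewrite (bigD1_seq x)//= eqxx mulr1 big1 ?addr0// => p px.
    by rewrite eq_sym (negPf px) mulr0.
  rewrite big_seq big1// => p ps.
  by have [xp|] := eqVneq x p; [rewrite xp ps in xs|rewrite mulr0].
by apply: kinkD; [exact: kink_affine|exact: kink_sum_hinges].
Qed.

Lemma pl_kink f u v x : pl f u v -> u < x < v -> exists w, kink f x w.
Proof.
move=> H xuv; have uv : u < v by lra.
have [c [d [s [w [us _ E]]]]] := pl_sum_hinges uv H.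
by exists (if x \in s then w x else 0); exact: (sum_hinges_kink us xuv E).
Qed.

(* Near x the maximum dominates the branch attaining it at x, so its second
   difference dominates that of the branch. *)
Lemma kink_max_ge0 f g x v w z : kink f x v -> kink g x w -> 0 <= v -> 0 <= w ->
  kink (fun y => Num.max (f y) (g y)) x z -> 0 <= z.
Proof.
move=> [c [n [n0 H]]] [c' [n' [n0' H']]] v0 w0 [k [m [m0 K]]].
pose e := Num.min n (Num.min n' m) / 2.
have mn0 : 0 < Num.min n (Num.min n' m) by rewrite !lt_min n0 n0' m0.
have e0 : 0 < e by rewrite divr_gt0.
have : e < Num.min n (Num.min n' m) by rewrite /e; lra.
rewrite !lt_min => /and3P[en en' em].
have [E1 E2] := H e ltac:(lra); have [E1' E2'] := H' e ltac:(lra).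
have [] := K e ltac:(lra).
set M1 := Num.max _ _; set M0 := Num.max _ _; set M2 := Num.max _ _ => Ka Kb.
have : f (x + e) <= M1 by rewrite le_max lexx.
have : g (x + e) <= M1 by rewrite le_max lexx orbT.
have : f (x - e) <= M2 by rewrite le_max lexx.
have : g (x - e) <= M2 by rewrite le_max lexx orbT.
have : M0 = f x \/ M0 = g x by rewrite /M0; case: leP; [right|left].
move=> H0 ? ? ? ?; rewrite leNgt; apply/negP => z0.
have : z * e < 0 by rewrite nmulr_rlt0.
have : 0 <= v * e by rewrite mulr_ge0// ltW.
have : 0 <= w * e by rewrite mulr_ge0// ltW.
case: H0 => H0; lra.
Qed.

(** A unit step at [b p] has integral [r - b p]. Nonnegative weights allow exchanging sum and
    integral. *)
Lemma Rintegral_sum_indic (s : seq R) (w b : R -> R) r :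
  {in s, forall p, 0 <= b p <= r} -> (forall p, 0 <= w p) ->
  \int[lebesgue_measure]_(t in `[0, r]) (\sum_(p <- s) w p * \1_(`]b p, +oo[) t)
  = \sum_(p <- s) w p * (r - b p).
Proof.
move=> bs w0; rewrite /Rintegral.
under eq_integral do rewrite -sumEFin.
rewrite ge0_integral_sum//=; last 2 first.
- move=> p; apply/measurable_EFinP; apply: measurable_funM => //.
- by move=> p t _; rewrite lee_fin mulr_ge0.
rewrite (_ : (\sum_(p <- s) _)%E = (\sum_(p <- s) w p * (r - b p))%:E)//.
rewrite -sumEFin; apply: eq_big_seq => p /bs bpr.
under eq_integral do rewrite EFinM.
transitivity ((w p)%:E *
    \int[lebesgue_measure]_(t in `[0%R, r]) (\1_(`]b p, +oo[) t)%:E)%E.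
  rewrite -ge0_integralZl_EFin//.
  by apply/measurable_EFinP; exact: measurable_indic.
rewrite integral_indic// (_ : _ `&` _ = `]b p, r]%classic); last first.
  apply/seteqP; split => t /=; rewrite !in_itv/= ?andbT; first by lra.
  by move=> tbr; split; lra.
rewrite [X in (_ * X)%E]lebesgue_measure_itv/= lte_fin EFinM -EFinB.
case: ltP => // rb; have -> : b p = r by lra.
by rewrite subrr.
Qed.

(** The tropical Jensen formula for a function without poles. A zero at [p] is counted from radius
    [|p|] on, so it adds [w p * (r - |p|)] to the integral; the affine part cancels on the
    right-hand side. *)
Lemma Npole_opp F r : 0 < r -> pl F (- r) r -> (forall x w, kink F x w -> 0 <= w) ->
  Npole (fun x => - F x) r = 2^-1 * (F r + F (- r)) - F 0.
Proof.
move=> r0 plF F_ge0; have rr : - r < r by lra.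
have [c [d [s [w [us sr E]]]]] := pl_sum_hinges rr plF.
have K x : - r < x < r -> kink F x (if x \in s then w x else 0).
  by move=> xr; exact: (sum_hinges_kink us xr E).
have w0 : {in s, forall p, 0 <= w p}.
  by move=> p ps; apply: (F_ge0 p); have := K _ (sr _ ps); rewrite ps.
have om x : - r < x < r -> omega (fun y => - F y) x = - (if x \in s then w x else 0).
  by move=> /K/kinkN/kink_omega.
(* [w] is known to be nonnegative only on [s]; its absolute value is nonnegative everywhere, as the
   integration lemma requires. *)
have pc t : t <= r ->
    pole_count (fun y => - F y) t = \sum_(p <- s) `|w p| * \1_(`]`|p|, +oo[) t.
  move=> tr; rewrite /pole_count.
  (* A hinge of weight zero is not a zero of [F], hence the filter on positive weights. *)
  rewrite (_ : [set x | _] = [set` [seq p <- s | (0 < w p) && (- t < p < t)]]); last first.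
    apply/seteqP; split => x /=.
      move=> [xt]; rewrite /is_pole om; last by lra.
      by case: ifPn => xs; rewrite mem_filter ?xs ?xt ?oppr0 ?ltxx// oppr_lt0 => ->.
    rewrite mem_filter => /andP[/andP[wx xt] xs]; split=> //.
    by rewrite /is_pole om ?xs ?oppr_lt0//; exact: sr.
  rewrite -fsbig_seq ?filter_uniq// big_filter big_mkcond/=.
  apply: eq_big_seq => p ps; rewrite om ?sr// ps opprK ger0_norm ?w0//.
  rewrite indicE mem_setE in_itv/= andbT ltr_norml.
  have := w0 _ ps; rewrite le_eqVlt => /orP[/eqP<-|->/=].
    by rewrite ltxx mul0r.
  by case: ifP; rewrite ?mulr1 ?mulr0.
rewrite /Npole.
have -> : \int[lebesgue_measure]_(t in `[0, r]) pole_count (fun y => - F y) t =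
    \sum_(p <- s) `|w p| * (r - `|p|).
  rewrite -Rintegral_sum_indic//; last first.
    move=> p /sr pr; rewrite normr_ge0/= ler_norml; lra.
  by apply: eq_Rintegral => t; rewrite inE/= in_itv/= => /andP[_ /pc].
rewrite !E; [|lra..].
(* For [p] in (-r, r), the second difference of its hinge at 0 with step [r] is exactly
   [r - |p|]. *)
have -> : \sum_(p <- s) `|w p| * (r - `|p|) =
    \sum_(p <- s) (w p * Num.max (r - p) 0 + w p * Num.max (- r - p) 0 -
                   2 * (w p * Num.max (0 - p) 0)).
  apply: eq_big_seq => p ps; have := sr _ ps; rewrite ger0_norm ?w0// => pr.
  rewrite (@max_l _ _ (r - p)) ?(@max_r _ _ (- r - p)); [|lra..].
  have [p0|p0] := leP 0 p; [rewrite max_r; last by lra|rewrite max_l; last by lra].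
    by rewrite ger0_norm//; ring.
  by rewrite ltr0_norm//; ring.
by rewrite !big_split/= sumrN -!mulr_sumr; field.
Qed.

End Kinks.

(** * Bounds on limits superior along a filter *)

Section Limsup.
Set Implicit Arguments.
Unset Strict Implicit.
Variables (R : realType) (F : set_system R).
Implicit Types (u : R -> R) (l : R).

Lemma limf_esup_le_near u l : (\forall x \near F, u x <= l) ->
  (limf_esup (fun x => (u x)%:E) F <= l%:E)%E.
Proof.
move=> H; apply: (@le_trans _ _ (ereal_sup ((fun x => (u x)%:E) @` [set x | u x <= l]))).
  by apply: ereal_inf_lbound; exists [set x | u x <= l].
by apply: ge_ereal_sup => _ [x /= xl <-]; rewrite lee_fin.
Qed.

Lemma limf_esup_ge_near {FF : ProperFilter F} u l : (\forall x \near F, l <= u x) ->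
  (l%:E <= limf_esup (fun x => (u x)%:E) F)%E.
Proof.
move=> H; apply: le_ereal_inf_tmp => _ [V FV <-].
have [x [/= xl Vx]] := filter_ex (filterI H FV).
apply: (@le_trans _ _ (u x)%:E); first by rewrite lee_fin.
by apply: ereal_sup_ubound; exists x.
Qed.

Lemma limf_esup_near {FF : ProperFilter F} u l :
  (forall e, 0 < e -> \forall x \near F, `|u x - l| <= e) ->
  limf_esup (fun x => (u x)%:E) F = l%:E.
Proof.
move=> H; apply/eqP; rewrite eq_le; apply/andP; split.
  apply/lee_addgt0Pr => e /H He; rewrite -EFinD; apply: limf_esup_le_near.
  by apply: filterS He => x; rewrite ler_norml; lra.
apply/lee_subgt0Pr => e /H He; rewrite -EFinB; apply: limf_esup_ge_near.
by apply: filterS He => x; rewrite ler_norml; lra.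
Qed.

End Limsup.

(** * Convexity and the growth of the characteristic function *)

Section Convex.
Set Implicit Arguments.
Unset Strict Implicit.
Variable R : realType.
Implicit Types f g : R -> R.

(** The chord inequality cleared of denominators, which suits linear arithmetic. *)
Definition convex3 f := forall x y z : R, x < y < z ->
  f y * (z - x) <= f x * (z - y) + f z * (y - x).

Lemma pl_convex f : (forall u v, pl f u v) -> (forall x w, kink f x w -> 0 <= w) ->
  convex3 f.
Proof.
move=> plf f_ge0 x y z xyz; have xz : x < z by lra.
have [c [d [s [w [us sr E]]]]] := pl_sum_hinges xz (plf x z).
rewrite !E; [|lra..].
(* The affine part gives equality, so only the hinges matter; each is convex and has nonnegative
   weight. *)
suff S : (\sum_(p <- s) w p * Num.max (y - p) 0) * (z - x) <=
    (\sum_(p <- s) w p * Num.max (x - p) 0) * (z - y) +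
    (\sum_(p <- s) w p * Num.max (z - p) 0) * (y - x) by lra.
rewrite !mulr_suml -big_split/= big_seq [leRHS]big_seq; apply: ler_sum => p ps.
have wp : 0 <= w p.
  by apply: (f_ge0 p); have := sum_hinges_kink us (sr _ ps) E; rewrite ps.
rewrite -!mulrA -mulrDr ler_wpM2l//.
have [yp|yp] := leP (y - p) 0.
  by rewrite mul0r; apply: addr_ge0; apply: mulr_ge0; rewrite ?le_max ?lexx ?orbT//; lra.
have : x - p <= Num.max (x - p) 0 by rewrite le_max lexx.
have : z - p <= Num.max (z - p) 0 by rewrite le_max lexx.
move: (Num.max _ _) (Num.max _ _) => A B pB pA.
have : 0 <= (A - (x - p)) * (z - y) by rewrite mulr_ge0//; lra.
have : 0 <= (B - (z - p)) * (y - x) by rewrite mulr_ge0//; lra.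
lra.
Qed.

Lemma convex3_max f g : convex3 f -> convex3 g -> convex3 (fun x => Num.max (f x) (g x)).
Proof.
move=> cf cg x y z xyz.
have le_end h : (forall t, h t <= Num.max (f t) (g t)) ->
    h x * (z - y) + h z * (y - x) <=
    Num.max (f x) (g x) * (z - y) + Num.max (f z) (g z) * (y - x).
  by move=> H; rewrite lerD// ler_wpM2r//; lra.
have [_|_] := leP (f y) (g y).
  by apply: le_trans (cg _ _ _ xyz) (le_end _ _) => t; rewrite le_max lexx orbT.
by apply: le_trans (cf _ _ _ xyz) (le_end _ _) => t; rewrite le_max lexx.
Qed.

(** A Liouville property: a convex function that takes two different values lies above the extended
    secant line, which becomes positive on one side. *)
Lemma convex3_le0_cst f : convex3 f -> (forall x, f x <= 0) -> forall x y, f x = f y.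
Proof.
move=> cf f0.
suff H x y : x < y -> f x = f y.
  by move=> x y; have [/H|/H|->] := ltgtP x y.
move=> xy; apply/eqP; rewrite eq_le; apply/andP; split; rewrite leNgt; apply/negP => fxy.
(* At [z] the line through the graph points over [x] and [y] has height 1, so convexity forces [f z]
   to be at least 1. The other case mirrors this to the right of [y]. *)
- pose z := x - (1 - f x) * (y - x) / (f x - f y).
  have D : 0 < f x - f y by lra.
  have zx : z < x.
    by rewrite /z ltrBlDr ltrDl divr_gt0// mulr_gt0//; have := f0 x; lra.
  have zxy : z < x < y by rewrite zx.
  have := cf _ _ _ zxy.
  have : (x - z) * (f x - f y) = (1 - f x) * (y - x).
    by rewrite /z; field; lra.
  have : f z * (y - x) <= 0 by rewrite pmulr_lle0// subr_gt0.
  lra.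
- pose z := y + (1 - f y) * (y - x) / (f y - f x).
  have D : 0 < f y - f x by lra.
  have yz : y < z.
    by rewrite /z ltrDl divr_gt0// mulr_gt0//; have := f0 y; lra.
  have xyz : x < y < z by rewrite xy.
  have := cf _ _ _ xyz.
  have : (z - y) * (f y - f x) = (1 - f y) * (y - x).
    by rewrite /z; field; lra.
  have : f z * (y - x) <= 0 by rewrite pmulr_lle0// subr_gt0.
  lra.
Qed.

(** Convexity bounds [f] by chords on both sides of 0; by symmetry the bound on the negative side
    reverses the one on the positive side, forcing equality. *)
Lemma convex3_sym_affine f : convex3 f -> (forall r, 0 < r -> f r + f (- r) = 2 * f 0) ->
  forall x, f x = f 0 + (f 1 - f 0) * x.
Proof.
move=> cf sym.
suff H x : 0 < x -> f x = f 0 + (f 1 - f 0) * x.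
  move=> x; have [x0|x0|<-] := ltgtP 0 x; [exact: H| |by ring].
  have nx0 : 0 < - x by lra.
  by have := sym _ nx0; rewrite opprK H//; lra.
move=> x0; have S1 := sym _ ltr01; have Sx := sym _ x0.
have S1x : (f 1 + f (- 1)) * x = 2 * f 0 * x by rewrite S1.
have [x1|x1|->] := ltgtP x 1; last by ring.
- have := cf 0 x 1; have := cf (-1) (- x) 0.
  by rewrite x0 x1 ltrN2 x1 oppr_lt0 x0 => /(_ isT) ? /(_ isT) ?; lra.
- have := cf 0 1 x; have := cf (- x) (-1) 0.
  by rewrite ltr01 x1 ltrN2 x1 oppr_lt0 ltr01 => /(_ isT) ? /(_ isT) ?; lra.
Qed.

Lemma convex3_sub_affine f c d : convex3 f -> convex3 (fun x => f x - (c * x + d)).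
Proof. by move=> cf x y z /cf; lra. Qed.

Lemma Tchar_comm f g r : Tchar f g r = Tchar g f r.
Proof. by rewrite /Tchar /tnorm !(maxC (f _)). Qed.

(** Add the chord inequalities of the maximum at [r0] over [0, r] and at [- r0] over [-r, 0]. *)
Lemma convex3_Tchar_ge f g r0 r : convex3 f -> convex3 g -> 0 < r0 < r ->
  r / r0 * Tchar f g r0 <= Tchar f g r.
Proof.
move=> cf cg r0r; have cM := convex3_max cf cg.
have := cM 0 r0 r r0r; have := cM (- r) (- r0) 0.
rewrite !ltrN2 => /(_ ltac:(lra)) A B.
have r00 : 0 < r0 by lra.
rewrite -(ler_pM2r r00) mulrAC divfK ?gt_eqF//.
rewrite /Tchar /tnorm; lra.
Qed.

Lemma convex3_Tchar_le0 f g : convex3 f -> convex3 g -> (forall r, 0 < r -> Tchar f g r <= 0) ->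
  forall x y, g x - f x = g y - f y.
Proof.
wlog g0f0 : f g / g 0 <= f 0.
  move=> H cf cg T0 x y; have [gf|fg] := leP (g 0) (f 0); first exact: H.
  suff : f x - g x = f y - g y by lra.
  apply: H => // [|r r0]; [exact: ltW|by rewrite Tchar_comm T0].
move=> cf cg T0.
have fM x : f x <= tnorm f g x by rewrite le_max lexx.
have gM x : g x <= tnorm f g x by rewrite le_max lexx orbT.
(* The maximum dominates [f] and equals it at 0, so a nonpositive characteristic squeezes it against
   the convexity of [f]: every inequality is an equality. *)
have key r : 0 < r -> [/\ f r + f (- r) = 2 * f 0, tnorm f g r = f r & tnorm f g (- r) = f (- r)].
  move=> r0; have := T0 r r0; rewrite /Tchar.
  have -> : tnorm f g 0 = f 0 by rewrite /tnorm max_l.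
  have := cf (- r) 0 r; rewrite oppr_lt0 r0 => /(_ isT) C.
  have : f 0 * 2 <= f (- r) + f r by rewrite -(ler_pM2r r0); lra.
  have := fM r; have := fM (- r); split; lra.
have aff := convex3_sym_affine cf (fun r r0 => let: And3 E _ _ := key r r0 in E).
have gf x : g x <= f x.
  have [x0|x0|<-//] := ltgtP 0 x; first by have [_ <- _] := key _ x0.
  have nx0 : 0 < - x by lra.
  by have [_ _] := key _ nx0; rewrite opprK => <-.
(* [f] is affine and dominates [g], so [g - f] is convex and nonpositive, hence constant. *)
move=> x y; rewrite (aff x) (aff y) (addrC _ (_ * x)) (addrC _ (_ * y)).
apply: (convex3_le0_cst (convex3_sub_affine (f 1 - f 0) (f 0) cg)) => z.
by have := gf z; rewrite (aff z); lra.
Qed.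

End Convex.

(** * Defects of values with real and with infinite coordinates *)

Section Defects.
Set Implicit Arguments.
Unset Strict Implicit.
Variable R : realType.
Implicit Types f g h : R -> R.

Lemma tropical_entire_kink h x w : tropical_entire h -> kink h x w -> 0 <= w.
Proof.
move=> [_ np] /kink_omega E; rewrite leNgt; apply/negP => w0.
by apply: (np x); rewrite /is_pole E.
Qed.

Lemma kink_shift b h x w : kink h x w -> kink (fun y => b + h y) x w.
Proof.
by move=> [c [n [n0 H]]]; exists c, n; split=> // e /H[-> ->]; rewrite !addrA.
Qed.

Lemma Npole_opp_max f g b c r : tropical_entire f -> tropical_entire g -> 0 < r ->
  let F x := Num.max (b + f x) (c + g x) in
  Npole (fun x => - F x) r = 2^-1 * (F r + F (- r)) - F 0.
Proof.
move=> ef eg r0 F.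
have plf u v : pl f u v by apply: tropical_meromorphic_pl; case: ef.
have plg u v : pl g u v by apply: tropical_meromorphic_pl; case: eg.
apply: Npole_opp => //; first by apply: pl_max; apply: plD => //; exact: pl_cst.
move=> x w.
have x1 : x - 1 < x < x + 1 by lra.
have [v kf] := pl_kink (plf _ _) x1; have [z kg] := pl_kink (plg _ _) x1.
apply: (kink_max_ge0 (kink_shift b kf) (kink_shift c kg)).
  exact: tropical_entire_kink kf.
exact: tropical_entire_kink kg.
Qed.

Lemma tropical_entire_convex3 h : tropical_entire h -> convex3 h.
Proof.
move=> eh; apply: pl_convex => [u v|x w]; last exact: tropical_entire_kink.
by apply: tropical_meromorphic_pl; case: eh.
Qed.

(** A single positive value at some [r0] suffices: beyond it the characteristic is at least linear
    in [r]. *)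
Lemma Tchar_infty f g : tropical_entire f -> tropical_entire g ->
  ~ (exists c, forall x, g x - f x = c) -> Tchar f g r @[r --> +oo] --> +oo.
Proof.
move=> /tropical_entire_convex3 cf /tropical_entire_convex3 cg nc.
have [r0 [r00 T0]] : exists r0, 0 < r0 /\ 0 < Tchar f g r0.
  apply: contrapT => H; apply: nc; exists (g 0 - f 0) => x.
  apply: convex3_Tchar_le0 => // r rpos; rewrite leNgt; apply/negP => Tr.
  by apply: H; exists r.
apply/cvgryPge => A; near=> r.
have rA : A / (Tchar f g r0 / r0) <= r.
  by near: r; apply: nbhs_pinfty_ge; rewrite num_real.
have rr0 : r0 < r by near: r; apply: nbhs_pinfty_gt; rewrite num_real.
rewrite ler_pdivrMr ?divr_gt0// in rA.
apply: le_trans rA _; rewrite mulrCA mulrC.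
by apply: convex3_Tchar_ge; rewrite ?r00.
Unshelve. all: by end_near. Qed.

Lemma defect_hc_eq0 f g (p : hcoord R) (b c : R) : tropical_entire f -> tropical_entire g ->
  ~ (exists k, forall x, g x - f x = k) -> hc0 p = b%:E -> hc1 p = c%:E ->
  defect_hc f g p = 0%E.
Proof.
move=> ef eg nc p0 p1; have Too := Tchar_infty ef eg nc.
pose F x := Num.max (b + f x) (c + g x).
have FE : (fun x => - tpoly_comp p f g x) = (fun x => - F x).
  by apply/funext => x; rewrite /tpoly_comp /tpoly p0 p1 -!EFinD -EFin_max.
rewrite /defect_hc FE (@limf_esup_near R _ _ _ 1) ?subee// => e e0.
(* [B] bounds the distance from [F] to the maximum of [f] and [g]. Two means and two values at 0
   then differ by at most [2 * B], which is negligible against the characteristic. *)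
pose B := `|b| + `|c|.
have FM x : `|F x - tnorm f g x| <= B.
  have := ler_norm b; have := ler_norm c; have := ler_norm (- b); have := ler_norm (- c).
  rewrite !normrN ler_norml /F /tnorm /B.
  have := normr_ge0 b; have := normr_ge0 c.
  by have [] := leP (f x) (g x); have [] := leP (b + f x) (c + g x); lra.
near=> r.
have r0 : 0 < r by near: r; apply: nbhs_pinfty_gt; rewrite num_real.
have T0 : 0 < Tchar f g r.
  by near: r; move/cvgryPgt : Too; apply.
have TB : 2 * B / e <= Tchar f g r.
  by near: r; move/cvgryPge : Too; apply.
rewrite Npole_opp_max// -/(F r) -/(F (- r)) -/(F 0).
rewrite -[X in _ - X](@divff _ (Tchar f g r)) ?gt_eqF// -mulrBl normrM normfV.
rewrite (gtr0_norm T0) ler_pdivrMr//.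
apply: (@le_trans _ _ (2 * B)); last by rewrite -ler_pdivrMl// mulrC.
have := FM r; have := FM (- r); have := FM 0; rewrite !ler_norml /Tchar; lra.
Unshelve. all: by end_near. Qed.

Lemma Npole_ge0 h r : 0 <= Npole h r.
Proof.
rewrite /Npole mulr_ge0//; apply: Rintegral_ge0 => t _; rewrite /pole_count.
by apply: fsumr_ge0 => x [_]; rewrite /is_pole oppr_ge0; exact: ltW.
Qed.

Lemma defect_hc_le1 f g (p : hcoord R) : tropical_entire f -> tropical_entire g ->
  ~ (exists k, forall x, g x - f x = k) -> (defect_hc f g p <= 1)%E.
Proof.
move=> ef eg nc; rewrite /defect_hc -[leRHS]sube0 leeB//.
apply: limf_esup_ge_near; near=> r; rewrite divr_ge0 ?Npole_ge0//.
by near: r; move/cvgryPge : (Tchar_infty ef eg nc); apply.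
Unshelve. all: by end_near. Qed.

(** By contraposition: a coordinate [-oo] leaves a single term in the maximum, so [ell] would be
    1. *)
Lemma ell_real_hcoord f g (p : hcoord R) : (ell f g (tpoly_comp p f g) < 2)%N = false ->
  exists b c, hc0 p = b%:E /\ hc1 p = c%:E.
Proof.
rewrite /ell; case: asboolP => // H _; move: H; rewrite /tpoly_comp /tpoly.
case: p => -[p1 p0]; rewrite /is_hcoord /hc0 /hc1 /=.
case: p1 p0 => [c||] [b||] //= i.
- by exists b, c.
- by case; exists c; right => x; rewrite maxNye.
- by case; exists b; left.
Qed.

End Defects.

Theorem theorem6p6 (R : realType) (f f0 f1 : R -> R)
  (f_mero : tropical_meromorphic f)
  (f_repr : represents f f0 f1)
  (f_nonconst : ~ exists c : R, forall x : R, f x = c)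
  (f_growth : limf_esup (fun r : R => (ln (Tchar f0 f1 r) / r)%:E)
                (pinfty_nbhs R) = 0%E) :
  (forall (q : nat) (a : nat -> hcoord R) (lam : nat),
     (forall i j : nat, (1 <= i <= q)%N -> (1 <= j <= q)%N -> i <> j ->
        tp_class (a i) <> tp_class (a j)) ->
     ddg f0 f1 [seq tpoly_comp (a j) f0 f1 | j <- index_iota 3 q.+1] = lam ->
     (\sum_(3 <= j < q.+1) defect f0 f1 (tp_class (a j)) <= (lam%:R)%:E)%E /\
     (lam = 0%N -> forall j : nat, (3 <= j <= q)%N ->
        defect f0 f1 (tp_class (a j)) = 0%E)) /\
  (forall a : R, ~ (forall x : R, Num.max (f x) a = a) ->
     defect f0 f1 (tp_of_real a) = 0%E).
Proof.
have [e0 e1 _ fE] := f_repr.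
have nc : ~ exists c, forall x, f1 x - f0 x = c.
  by move=> [c H]; apply: f_nonconst; exists c => x; rewrite fE.
split=> [q a lam _ ddgE|a _]; last first.
  (* A real [a] has the two real coordinates [a] and 0. *)
  by rewrite /tp_of_real defect_class (@defect_hc_eq0 _ _ _ _ a 0).
have defect0 p : (ell f0 f1 (tpoly_comp p f0 f1) < 2)%N = false ->
    defect f0 f1 (tp_class p) = 0%E.
  by move=> /ell_real_hcoord[b [c [pb pc]]]; rewrite defect_class (defect_hc_eq0 e0 e1 nc pb pc).
split.
  (* As a sum of ones over the counted indices, [ddg] can be compared term by term: a defect is at
     most 1 at a counted index and 0 elsewhere. *)
  rewrite -ddgE /ddg count_map -sum1_count natr_sum -sumEFin [leRHS]big_mkcond/=.
  apply: lee_sum => j _; case: ifPn => [_|/negbTE/defect0 ->//].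
  by rewrite defect_class defect_hc_le1.
move=> lam0 j jq; apply: defect0; apply/negbTE; move: ddgE.
rewrite lam0 /ddg count_map => /eqP; rewrite -leqn0 leqNgt -has_count => /hasPn; apply.
by rewrite mem_index_iota ltnS.
Qed.
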